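(* Let $\alpha,\beta,\gamma\in Z$ be such that $\rho(\alpha)$, $\rho(\beta)$ and $\rho(\gamma)$ are pairwise distinct. Then the intersection $T_W(\alpha,\beta,\gamma)\cap(\mathbb{C}\times Z)$ is contained in \[ \bigl\{\bigl(-(\alpha^2+\alpha\beta+\beta^2),\,\alpha\beta(\alpha+\beta)\bigr),\ \bigl(-(\alpha^2+\alpha\gamma+\gamma^2),\,\alpha\gamma(\alpha+\gamma)\bigr),\ \bigl(-(\beta^2+\beta\gamma+\gamma^2),\,\beta\gamma(\beta+\gamma)\bigr)\bigr\}. \]
   Context: For $(A,B)\in\mathbb{C}^2$ with $4A^3+27B^2\neq 0$ let $E_{A,B}\colon y^2=x^3+Ax+B$. For $\alpha\in\mathbb{C}$ let $P_\alpha(A,B)$ be a point on $E_{A,B}$ with $x$-coordinate $\alpha$ (well defined up to sign), and define \[ T_W(\alpha)=\{(A,B)\in\mathbb{C}^2 : 4A^3+27B^2\neq 0,\ P_\alpha(A,B)\text{ is a torsion point of } E_{A,B}\}, \] and $T_W(\alpha_1,\dots,\alpha_n)=T_W(\alpha_1)\cap\dots\cap T_W(\alpha_n)$. Let $\bar{\mathbb{Q}}\subseteq\mathbb{C}$ be the algebraic closure of $\mathbb{Q}$. Fix an embedding $i\colon\bar{\mathbb{Q}}\hookrightarrow\bar{\mathbb{Q}}_2$, let $Z\subseteq\bar{\mathbb{Q}}$ be the subring of elements $\alpha$ such that $i(\alpha)$ is integral, and for $\alpha\in Z$ let $\rho(\alpha)\in\bar{\mathbb{F}}_2$ be the residue class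 of $i(\alpha)$. *)

(* Defs.v *)
From HB Require Import structures.
From mathcomp Require Import all_boot all_order all_algebra.
From mathcomp Require Import complex boolp classical_sets reals.

Set Implicit Arguments.
Unset Strict Implicit.
Unset Printing Implicit Defensive.

Import Order.TTheory GRing.Theory Num.Theory.
Local Open Scope ring_scope.

(* Z_2 as the inverse limit of the rings Z/2^n: an element is the sequence of
   its residues [x n], with [0 <= x n < 2 ^ n].  The bound is not stated
   separately since it follows from the compatibility condition. *)
Definition dyadic_coherent (x : nat -> nat) : Prop :=
  forall n, (x n.+1 %% 2 ^ n)%N = x n.

Record Z2 := MkZ2 { z2res : nat -> nat; _ : `[< dyadic_coherent z2res >] }.

HB.instance Definition _ := [isSub for z2res].
HB.instance Definition _ := gen_eqMixin Z2.
HB.instance Definition _ := gen_choiceMixin Z2.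

Lemma z2P (x : Z2) : dyadic_coherent (z2res x).
Proof. by case: x => x /= /asboolP. Qed.

Lemma z2_ext (x y : Z2) : z2res x =1 z2res y -> x = y.
Proof. by move=> xy; apply/val_inj/funext. Qed.

Lemma z2_mod (x : Z2) n : (z2res x n %% 2 ^ n)%N = z2res x n.
Proof. by rewrite -(z2P x n) modn_mod. Qed.

Lemma z2_le (x : Z2) n m : (n <= m)%N -> (z2res x m %% 2 ^ n)%N = z2res x n.
Proof.
move=> /subnK <-; elim: (m - n)%N => [|k IH]; first by rewrite add0n z2_mod.
rewrite -IH -(z2P x (k + n)) addSn modn_dvdm //.
by rewrite dvdn_exp2l // leq_addl.
Qed.

Lemma modn_exp2S m n : (m %% 2 ^ n.+1 = m %[mod 2 ^ n])%N.
Proof. by rewrite modn_dvdm // dvdn_exp2l. Qed.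

Section MkZ2.
Variable f : nat -> nat.
Hypothesis fP : forall n, (f n.+1 = f n %[mod 2 ^ n])%N.
Fact mkZ2_subproof : `[< dyadic_coherent (fun n => f n %% 2 ^ n)%N >].
Proof. by apply/asboolP => n; rewrite modn_exp2S fP. Qed.
Definition mkZ2 : Z2 := MkZ2 mkZ2_subproof.
End MkZ2.

Fact z2_nat_subproof (k n : nat) : (k = k %[mod 2 ^ n])%N. Proof. by []. Qed.
Definition z2_nat (k : nat) : Z2 := mkZ2 (z2_nat_subproof k).

Fact z2_add_subproof (x y : Z2) n :
  (z2res x n.+1 + z2res y n.+1 = z2res x n + z2res y n %[mod 2 ^ n])%N.
Proof. by rewrite -modnDm !z2P. Qed.
Definition z2_add (x y : Z2) : Z2 := mkZ2 (z2_add_subproof x y).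

Fact z2_opp_subproof (x : Z2) n :
  (2 ^ n.+1 - z2res x n.+1 = 2 ^ n - z2res x n %[mod 2 ^ n])%N.
Proof.
have lex m : (z2res x m <= 2 ^ m)%N.
  by rewrite -z2_mod ltnW // ltn_pmod // expn_gt0.
apply/eqP; rewrite -(eqn_modDr (z2res x n.+1)) subnK //.
rewrite -modnDmr z2P subnK // expnS modnMl; exact/eqP/esym/modnn.
Qed.
Definition z2_opp (x : Z2) : Z2 := mkZ2 (z2_opp_subproof x).

Fact z2_mul_subproof (x y : Z2) n :
  (z2res x n.+1 * z2res y n.+1 = z2res x n * z2res y n %[mod 2 ^ n])%N.
Proof. by rewrite -modnMm !z2P. Qed.
Definition z2_mul (x y : Z2) : Z2 := mkZ2 (z2_mul_subproof x y).

Fact z2_addA : associative z2_add.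
Proof. by move=> x y z; apply: z2_ext => n /=; rewrite modnDmr modnDml addnA. Qed.
Fact z2_addC : commutative z2_add.
Proof. by move=> x y; apply: z2_ext => n /=; rewrite addnC. Qed.
Fact z2_add0 : left_id (z2_nat 0) z2_add.
Proof. by move=> x; apply: z2_ext => n /=; rewrite mod0n add0n z2_mod. Qed.
Fact z2_addN : left_inverse (z2_nat 0) z2_opp z2_add.
Proof.
move=> x; apply: z2_ext => n /=; rewrite modnDml subnK ?modnn ?mod0n //.
by rewrite -z2_mod ltnW // ltn_pmod // expn_gt0.
Qed.

HB.instance Definition _ :=
  GRing.isZmodule.Build Z2 z2_addA z2_addC z2_add0 z2_addN.

Fact z2_mulA : associative z2_mul.
Proof. by move=> x y z; apply: z2_ext => n /=; rewrite modnMmr modnMml mulnA. Qed.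
Fact z2_mulC : commutative z2_mul.
Proof. by move=> x y; apply: z2_ext => n /=; rewrite mulnC. Qed.
Fact z2_mul1 : left_id (z2_nat 1) z2_mul.
Proof. by move=> x; apply: z2_ext => n /=; rewrite modnMml mul1n z2_mod. Qed.
Fact z2_mulD : left_distributive z2_mul z2_add.
Proof.
by move=> x y z; apply: z2_ext => n /=; rewrite modnMml modnDm mulnDl.
Qed.
Fact z2_neq01 : z2_nat 1 != 0.
Proof. by apply/eqP => /(congr1 (fun x : Z2 => z2res x 1)). Qed.

HB.instance Definition _ := GRing.Zmodule_isComNzRing.Build Z2
  z2_mulA z2_mulC z2_mul1 z2_mulD z2_neq01.

Definition z2_unit : {pred Z2} := fun x => `[< exists y : Z2, y * x = 1 >].
Definition z2_inv (x : Z2) : Z2 :=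
  if pselect (exists y : Z2, y * x = 1) is left ex then projT1 (cid ex) else x.

Fact z2_mulV : {in z2_unit, left_inverse 1 z2_inv *%R}.
Proof.
move=> x /asboolP ex; rewrite /z2_inv; case: pselect => // ex'.
by case: (cid ex').
Qed.
Fact z2_unitP (x y : Z2) : y * x = 1 -> z2_unit x.
Proof. by move=> yx; apply/asboolP; exists y. Qed.
Fact z2_inv_out : {in [predC z2_unit], z2_inv =1 id}.
Proof.
by move=> x /asboolP nx; rewrite /z2_inv; case: pselect.
Qed.

HB.instance Definition _ := GRing.ComNzRing_hasMulInverse.Build Z2
  z2_mulV z2_unitP z2_inv_out.

Lemma z2_neq0 (x : Z2) : x != 0 -> exists n, z2res x n != 0%N.
Proof.
move=> x0; apply: contrapT => /forallNP xn; move/eqP: x0; apply.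
by apply: z2_ext => n; rewrite /= mod0n; apply/eqP; rewrite -[_ == _]negbK; apply/negP.
Qed.

Fact z2_idomain (x y : Z2) : x * y = 0 -> (x == 0) || (y == 0).
Proof.
move=> xy0; rewrite -[_ || _]negbK negb_or; apply/negP => /andP[].
move=> /z2_neq0[n xn] /z2_neq0[m ym].
have ndvd (z : Z2) k l : (k <= l)%N -> z2res z k != 0%N ->
    (0 < z2res z l)%N /\ (logn 2 (z2res z l) < k)%N.
  move=> kl zk; have ndv : ~~ (2 ^ k %| z2res z l)%N by rewrite /dvdn z2_le.
  have z0 : (0 < z2res z l)%N.
    by rewrite lt0n; apply: contra ndv => /eqP ->; rewrite dvdn0.
  by split=> //; rewrite ltnNge -pfactor_dvdn.
have [x0 lx] := ndvd x n (n + m)%N (leq_addr _ _) xn.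
have [y0 ly] := ndvd y m (n + m)%N (leq_addl _ _) ym.
have /(congr1 (fun z : Z2 => z2res z (n + m)%N)) /= := xy0.
rewrite mod0n => /eqP; rewrite -/(dvdn _ _) pfactor_dvdn ?muln_gt0 ?x0 //.
rewrite lognM // leqNgt => /negP; apply.
by rewrite -addSn leq_add // ltnW.
Qed.

HB.instance Definition _ := GRing.ComUnitRing_isIntegral.Build Z2 z2_idomain.

Definition Q2 : fieldType := {fraction Z2}.
Definition Z2_to_Q2 : {rmorphism Z2 -> Q2} := @tofrac Z2.

Definition is_algebraic_closure (F : fieldType) (L : closedFieldType)
  (iota : {rmorphism F -> L}) : Prop := forall x : L, algebraicOver iota x.

Section Integers.
Variables (L : fieldType) (iota : {rmorphism Q2 -> L}).

Definition integral2 : {pred L} :=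
  fun x => `[< integralOver (iota \o Z2_to_Q2) x >].

Fact integral2_subring : subring_closed integral2.
Proof.
split=> [|x y /asboolP ix /asboolP iy|x y /asboolP ix /asboolP iy]; apply/asboolP.
- exact: integral1.
- exact: integral_sub.
- exact: integral_mul.
Qed.
HB.instance Definition _ := GRing.isSubringClosed.Build L integral2
  integral2_subring.

Record ring_of_integers := MkInt { int_val : L; _ : int_val \in integral2 }.
HB.instance Definition _ := [isSub for int_val].
HB.instance Definition _ := [Choice of ring_of_integers by <:].
HB.instance Definition _ := [SubChoice_isSubComNzRing of ring_of_integers by <:].

(* [red] is the quotient map of the ring of integers of [L] by its maximal
   ideal, the set of its non-units. *)
Definition is_residue_map (k : fieldType)
    (red : {rmorphism ring_of_integers -> k}) : Prop :=
  (forall y : k, exists x, red x = y) /\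
  (forall x, red x = 0 <-> ~ (exists y, x * y = 1)).

End Integers.

Section AlgebraicNumbers.
Variable R : realType.

Definition algebraic_number : {pred R[i]} :=
  fun z => `[< algebraicOver (ratr : rat -> R[i]) z >].

Fact algebraic_number_divring : divring_closed algebraic_number.
Proof.
split=> [|x y /asboolP ax /asboolP ay|x y /asboolP ax /asboolP ay]; apply/asboolP.
- exact: algebraic1.
- exact: algebraic_sub.
- exact: algebraic_div.
Qed.
HB.instance Definition _ := GRing.isDivringClosed.Build R[i] algebraic_number
  algebraic_number_divring.

Record Qbar := MkQbar { Qbar_val :> R[i]; _ : Qbar_val \in algebraic_number }.
HB.instance Definition _ := [isSub for Qbar_val].
HB.instance Definition _ := [Choice of Qbar by <:].
HB.instance Definition _ := [SubChoice_isSubComUnitRing of Qbar by <:].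
HB.instance Definition _ := [SubComUnitRing_isSubIntegralDomain of Qbar by <:].
HB.instance Definition _ := [SubIntegralDomain_isSubField of Qbar by <:].

End AlgebraicNumbers.

Section TwoIntegralNumbers.
Variables (R : realType) (L : fieldType) (iota : {rmorphism Q2 -> L}).
Variable i : {rmorphism Qbar R -> L}.

Definition Zpred : {pred Qbar R} := fun a => i a \in integral2 iota.

Fact Zpred_subring : subring_closed Zpred.
Proof.
split=> [|x y ix iy|x y ix iy]; rewrite /in_mem /= /Zpred.
- by rewrite rmorph1 rpred1.
- by rewrite rmorphB rpredB.
- by rewrite rmorphM rpredM.
Qed.
HB.instance Definition _ := GRing.isSubringClosed.Build (Qbar R) Zpred
  Zpred_subring.

Record Zsub := MkZsub { Zsub_val :> Qbar R; _ : Zsub_val \in Zpred }.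
HB.instance Definition _ := [isSub for Zsub_val].
HB.instance Definition _ := [Choice of Zsub by <:].
HB.instance Definition _ := [SubChoice_isSubComNzRing of Zsub by <:].

Definition Zset : set R[i] := range (fun a : Zsub => Qbar_val a).

Definition rho (k : fieldType) (red : {rmorphism ring_of_integers iota -> k})
  (a : Zsub) : k := red (MkInt (valP a)).

End TwoIntegralNumbers.

Section EllipticCurves.
Variable F : fieldType.

Inductive wpoint := Infinity | Affine of F & F.

Definition on_curve (A B : F) (P : wpoint) : Prop :=
  if P is Affine x y then y ^+ 2 = x ^+ 3 + A * x + B else True.

Definition chord (x1 y1 x2 s : F) : wpoint :=
  let x3 := s ^+ 2 - x1 - x2 in Affine x3 (s * (x1 - x3) - y1).

(* The chord-and-tangent law, meaningful on points of one curve
   y^2 = x^3 + A x + B: two such points with the same abscissa are either equal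
   or opposite, so the last branch is reached only for P = Q with y <> 0. *)
Definition wadd (A : F) (P Q : wpoint) : wpoint :=
  match P, Q with
  | Infinity, _ => Q
  | _, Infinity => P
  | Affine x1 y1, Affine x2 y2 =>
      if x1 != x2 then chord x1 y1 x2 ((y2 - y1) / (x2 - x1))
      else if y1 == - y2 then Infinity
      else chord x1 y1 x2 ((3%:R * x1 ^+ 2 + A) / (2%:R * y1))
  end.

Definition wmuln (A : F) (n : nat) (P : wpoint) : wpoint :=
  iter n (wadd A P) Infinity.

Definition is_torsion (A : F) (P : wpoint) : Prop :=
  exists2 n : nat, (0 < n)%N & wmuln A n P = Infinity.

(* The points of abscissa [a] are opposite to each other, so the choice of the
   ordinate [y] is irrelevant. *)
Definition T_W (a : F) : set (F * F) :=
  [set AB | 4%:R * AB.1 ^+ 3 + 27%:R * AB.2 ^+ 2 != 0 /\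
    exists y, on_curve AB.1 AB.2 (Affine a y) /\ is_torsion AB.1 (Affine a y)]%classic.

Definition T_Ws (s : seq F) : set (F * F) :=
  (\bigcap_(a in [set` s]) T_W a)%classic.

End EllipticCurves.

Arguments Infinity {F}.

(* Main.v *)
Require Import Defs.
From HB Require Import structures.
From mathcomp Require Import all_boot all_order all_algebra ring zify.
From mathcomp Require Import complex boolp classical_sets reals.

(** A valuation argument at a prime above [2], carried out in the field of complex
    numbers itself. The ring [Z] does not contain [1/2], so it lies in a valuation
    ring [O] of the complex numbers with [2] in its maximal ideal
    ([valuation_ring_exists]). The differences of the three abscissas
    are units of [Z], hence of [O] ([Zset_sub_unit]). The ring [O] has to
    live in the complex numbers because [A] is an arbitrary complex number.

    Modulo the maximal ideal the curve [y^2 = x^3 + A x + B] has a cusp, at the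
    abscissa with [x^2 = A]. The key fact is that a torsion point
    with integral abscissa and [y != 0] reduces to this cusp
    ([torsion_reduces_to_cusp]). As squaring is injective in characteristic two,
    two such points have abscissas with small difference. Among three points with
    abscissas distinct modulo the maximal ideal, two at least therefore have
    [y = 0], and these two determine [A] and [B] as in the conclusion
    ([two_torsion_coefficients]).

    For the key fact, let [P] have nonsingular reduction
    ([nonsingular_reduction_not_torsion]). The smooth part of the reduction is an
    additive group of characteristic two, so [k P] is in the kernel of reduction
    for [k] even and reduces to the same point as [P] for [k] odd
    ([wmuln_near]). If [P] has finite order [N], then [N] is even, and the point
    [(N / 2) P] of order two has integral abscissa, so [N / 2] is odd. This last
    case means that [P] differs from a point of order two by a point of odd order
    in the kernel of reduction. It is excluded by computing the exact valuation of
    [x(P) - x(k P)] for [N / 2 <= k < N] ([order_not_twice_odd]).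

    The sequence [k P] is followed one addition of [P] at a time, through the
    relation satisfied by the abscissas of three collinear points
    ([collinear_abscissas]), the cancellation law [Z = (P + Z) - P]
    ([wadd_cancel]) and the recurrence satisfied by [x(P) - x(k P)]
    ([gap_recurrence]). *)

Set Implicit Arguments.
Unset Strict Implicit.
Unset Printing Implicit Defensive.

Import GRing.Theory Num.Theory.
Local Open Scope ring_scope.
Local Open Scope classical_set_scope.

(** * Valuation rings avoiding the inverse of a non-unit *)

Definition adjoin (K : fieldType) (S : {pred K}) (x : K) : {pred K} :=
  fun v => `[< exists2 q : {poly K}, q \is a polyOver S & v = q.[x] >].

Section Adjoin.
Variables (K : fieldType) (S : subringClosed K) (x : K).

Lemma adjoin_subring : subring_closed (adjoin S x).
Proof.
split=> [|_ _ /asboolP[q Sq ->] /asboolP[r Sr ->]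
         |_ _ /asboolP[q Sq ->] /asboolP[r Sr ->]]; apply/asboolP.
- by exists 1; rewrite ?rpred1 ?hornerC.
- by exists (q - r); rewrite ?rpredB // hornerD hornerN.
- by exists (q * r); rewrite ?rpredM // hornerM.
Qed.

Lemma sub_adjoin : {subset S <= adjoin S x}.
Proof. by move=> a Sa; apply/asboolP; exists a%:P; rewrite ?polyOverC ?hornerC. Qed.

Lemma mem_adjoin : x \in adjoin S x.
Proof. by apply/asboolP; exists 'X; rewrite ?polyOverX ?hornerX. Qed.

End Adjoin.

(** The hypothesis [maxS] is what maximality of [S] among the subrings that
    avoid [p^-1] gives for the rings [S[x]]. *)
Section Maximal.
Variables (K : fieldType) (S : subringClosed K) (p : K).
Hypothesis Sp : p \in S.
Hypothesis Sp' : p^-1 \notin S.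
Hypothesis maxS : forall x : K, x \notin S -> p^-1 \in adjoin S x.

Let p_neq0 : p != 0.
Proof. by apply: contraNneq Sp' => ->; rewrite invr0 rpred0. Qed.

Lemma pow_one_sub (b : K) n :
  b \in S -> exists2 c, c \in S & (1 - p * b) ^+ n = 1 - p * c.
Proof.
move=> Sb; elim: n => [|n [c Sc IH]]; first by exists 0; rewrite ?rpred0 ?mulr0 ?subr0.
exists (b + c - p * b * c); first by rewrite rpredB ?rpredD ?rpredM.
by rewrite exprS IH; ring.
Qed.

(** Adjoining the inverse of [u = 1 - p b] to [S] cannot create [p^-1]: clearing
    denominators would give [u ^+ n = p s], whereas [u ^+ n] is [1] modulo [p]. *)
Lemma one_sub_unit (b : K) : b \in S -> (1 - p * b)^-1 \in S.
Proof.
move=> Sb; set u := 1 - p * b; apply: contraT => Su'.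
have u0 : u != 0 by apply: contraNneq Su' => ->; rewrite invr0 rpred0.
have /asboolP[q Sq pq] := maxS Su'.
have [c Sc uc] := pow_one_sub (size q) Sb.
have [s Ss us] : exists2 s, s \in S & u ^+ size q = p * s.
  exists (\sum_(i < size q) q`_i * u ^+ (size q - i)).
    rewrite rpred_sum // => i _; rewrite rpredM ?rpredX ?rpredB ?rpred1 ?rpredM //.
    exact: (polyOverP Sq).
  have : p * q.[u^-1] = 1 by rewrite -pq divff.
  rewrite horner_coef => /(congr1 ( *%R^~ (u ^+ size q))).
  rewrite mul1r -mulrA => <-; congr (_ * _); rewrite mulr_suml.
  apply: eq_bigr => i _; rewrite -mulrA; congr (_ * _).
  by rewrite exprVn expfB_cond ?(negPf u0) ?add0n ?(ltnW (ltn_ord i)) // mulrC.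
have pE : p^-1 = s + c.
  apply: (mulfI p_neq0); rewrite divff // mulrDr -us -[u]/(1 - p * b) uc.
  by rewrite subrK.
by have := Sp'; rewrite pE rpredD.
Qed.

(** The relation [p^-1 = r(x^-1)] makes [x] integral: since [1 - p r_0] is a
    unit, multiplying by [x ^+ deg r] expresses that power through lower ones.
    This lowers the degree of any relation [p^-1 = q(x)] with
    [deg q >= deg r]. *)
Lemma shorten_inverse_relation (x : K) (q r : {poly K}) : x != 0 ->
    q \is a polyOver S -> r \is a polyOver S ->
    p^-1 = q.[x] -> p^-1 = r.[x^-1] -> (size r <= size q)%N ->
  exists q' : {poly K},
    [/\ q' \is a polyOver S, p^-1 = q'.[x] & (size q' < size q)%N].
Proof.
move=> x0 /polyOverP Sq /polyOverP Sr qx rx rq.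
have p'0 : p^-1 != 0 by rewrite invr_eq0.
have q0 : (0 < size q)%N.
  by rewrite lt0n size_poly_eq0; apply: contraNneq p'0 => q0; rewrite qx q0 horner0.
have r0 : (0 < size r)%N.
  by rewrite lt0n size_poly_eq0; apply: contraNneq p'0 => r0; rewrite rx r0 horner0.
case sq: (size q) q0 rq => [//|N] _; case sr: (size r) r0 => [//|M] _.
rewrite ltnS => MN.
set u := 1 - p * r`_0.
have u0 : u != 0.
  rewrite subr_eq0 eq_sym; apply: contraNneq Sp' => pr.
  by rewrite -[p^-1]mulr1 -pr mulKf.
have Su' : u^-1 \in S by exact: one_sub_unit.
have xM : x ^+ M = \sum_(i < M) u^-1 * p * r`_i.+1 * x ^+ (M - i.+1).
  have uE : u = \sum_(i < M) p * r`_i.+1 * x^-1 ^+ i.+1.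
    have : p * r.[x^-1] = 1 by rewrite -rx divff.
    rewrite horner_coef sr big_ord_recl /= expr0 mulr1 mulrDr => /(canRL (addKr _)).
    rewrite [- _ + 1]addrC -/u => <-; rewrite mulr_sumr.
    by apply: eq_bigr => i _; rewrite mulrA.
  apply: (mulfI u0); rewrite {1}uE mulr_suml mulr_sumr.
  apply: eq_bigr => i _; rewrite !mulrA divff // mul1r -!mulrA; congr (_ * (_ * _)).
  by rewrite exprVn expfB_cond ?(negPf x0) ?add0n // mulrC.
(* the leading term of [q], rewritten with [xM], goes down in degree *)
pose g := \poly_(i < N) q`_i +
  q`_N *: \sum_(i < M) (u^-1 * p * r`_i.+1) *: 'X^(N - i.+1).
exists g; split.
- rewrite rpredD //; first by apply/polyOver_poly => i _.
  apply: polyOverZ => //; apply: rpred_sum => i _.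
  by rewrite polyOverZ ?rpredM ?rpredX ?polyOverX.
- rewrite qx horner_coef sq big_ord_recr /= /g hornerD horner_poly hornerZ.
  congr (_ + _ * _); rewrite -{1}(subnK MN) exprD xM mulr_sumr horner_sum.
  apply: eq_bigr => i _; rewrite hornerZ hornerXn mulrCA; congr (_ * _).
  by rewrite -exprD addnBA // subnK.
- rewrite ltnS (leq_trans (size_polyD _ _)) // geq_max size_poly /=.
  rewrite (leq_trans (size_scale_leq _ _)) //.
  apply: (leq_trans (size_sum _ _ _)); apply/bigmax_leqP => i _.
  rewrite (leq_trans (size_scale_leq _ _)) // size_polyXn.
  by rewrite -subSn ?subSS ?leq_subr // (leq_trans (ltn_ord i)).
Qed.

(** If neither [x] nor [x^-1] lies in [S], both rings [S[x]] and [S[x^-1]]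
    contain [p^-1], and the two relations shorten each other forever. *)
Lemma maximal_valuation (x : K) : x \in S \/ x^-1 \in S.
Proof.
apply: contrapT => /not_orP[/negP Sx /negP Sx'].
have x0 : x != 0 by apply: contraNneq Sx => ->; rewrite rpred0.
have /asboolP[q Sq qx] := maxS Sx; have /asboolP[r Sr rx] := maxS Sx'.
have [n] := ubnP (size q + size r)%N.
elim: n => // n IH in q Sq qx r Sr rx *; rewrite ltnS => le_n.
have [rq|/ltnW qr] := leqP (size r) (size q).
  have [q' [Sq' qx' lt_q]] := shorten_inverse_relation x0 Sq Sr qx rx rq.
  by apply: (IH q' Sq' qx' r Sr rx); apply: leq_trans le_n; rewrite ltn_add2r.
have x'0 : x^-1 != 0 by rewrite invr_eq0.
rewrite -{1}[x]invrK in qx.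
have [r' [Sr' rx' lt_r]] := shorten_inverse_relation x'0 Sr Sq rx qx qr.
rewrite invrK in qx.
by apply: (IH q Sq qx r' Sr' rx'); apply: leq_trans le_n; rewrite ltn_add2l.
Qed.

End Maximal.

(** Chevalley's extension theorem for a single element: by Zorn's lemma there is a
    largest subring that avoids [p^-1]. *)
Lemma valuation_ring_exists (K : fieldType) (Z : subringClosed K) (p : K) :
    p \in Z -> p^-1 \notin Z ->
  exists O : subringClosed K,
    [/\ {subset Z <= O}, p^-1 \notin O & forall x, x \in O \/ x^-1 \in O].
Proof.
move=> Zp Zp'.
pose good (X : set K) := [/\ subring_closed [in X], {subset Z <= X} & p^-1 \notin X].
(* [set0] is allowed because the union of the empty chain must qualify *)
pose P (X : set K) := X = set0 \/ good X.
have [F FP Ftot|X [PX maxX]] := @Zorn_bigcup K P.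
  have [F0|/existsNP[X1 /not_implyP[FX1 X10]]] := pselect (F `<=` [set set0]).
    by left; apply/seteqP; split=> // x [X /F0 -> ].
  right; have gF X x : F X -> x \in X -> good X.
    by move=> /FP[->|//]; rewrite in_set0.
  have gX1 : good X1 by case: (FP _ FX1).
  have common x y : x \in \bigcup_(X in F) X -> y \in \bigcup_(X in F) X ->
      exists X, [/\ F X, x \in X & y \in X].
    rewrite !in_setE => -[X FX Xx] [Y FY Yy].
    have [XY|YX] := Ftot _ _ FX FY.
      by exists Y; rewrite !in_setE; split=> //; apply: XY.
    by exists X; rewrite !in_setE; split=> //; apply: YX.
  have inF X x : F X -> x \in X -> x \in \bigcup_(X in F) X.
    by rewrite !in_setE => FX Xx; exists X.
  split.
  - split=> [|x y Fx Fy|x y Fx Fy].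
    + by case: gX1 => -[X11 _ _] _ _; apply: (inF _ _ FX1).
    + have [X [FX Xx Xy]] := common _ _ Fx Fy.
      by have [[_ XB _] _ _] := gF _ _ FX Xx; apply: (inF _ _ FX); apply: XB.
    + have [X [FX Xx Xy]] := common _ _ Fx Fy.
      by have [[_ _ XM] _ _] := gF _ _ FX Xx; apply: (inF _ _ FX); apply: XM.
  - by move=> z Zz; case: gX1 => _ ZX1 _; apply: (inF _ _ FX1); apply: ZX1.
  - apply/negP => Fp; have [X [FX Xp _]] := common _ _ Fp Fp.
    by have [_ _] := gF _ _ FX Xp; rewrite Xp.
have gZ : good [set` Z].
  split=> [|z|]; rewrite ?mem_setE //.
  by split=> [|x y|x y]; rewrite /= ?mem_setE; [exact: rpred1|exact: rpredB|exact: rpredM].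
have [Sring ZS Sp'] : good X.
  case: PX => // X0; case: (maxX [set` Z]); last by right.
  by rewrite X0; split=> // /(_ 0); apply; exact: rpred0.
pose S : subringClosed K := HB.pack [in X] (GRing.isSubringClosed.Build K _ Sring).
exists S; split=> // x; apply: (@maximal_valuation _ S p (ZS p Zp) Sp') => {}x Sx.
rewrite -[_ \in _]negbK; apply/negP => Ap'.
case: (maxX [set` adjoin S x]).
  split=> [y Xy|/(_ x)].
    by apply: sub_adjoin; rewrite -topredE /= in_setE.
  move=> /(_ (mem_adjoin S x)) Xx; case/negP: Sx.
  by rewrite -topredE /= in_setE.
right; split=> [|z Zz|]; rewrite ?mem_setE //; last exact/sub_adjoin/ZS.
have [A1 AB AM] := adjoin_subring S x.
by split=> [|u v|u v]; rewrite /= ?mem_setE; [exact: A1|exact: AB|exact: AM].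
Qed.

(** * The maximal ideal and the units of a valuation ring *)

(** The maximal ideal of a valuation ring [O], described inside the field. *)
Definition small (K : fieldType) (O : {pred K}) : {pred K} :=
  fun x => (x == 0) || (x^-1 \notin O).

Section SmallElements.
Variables (K : fieldType) (O : subringClosed K).
Hypothesis valO : forall x, x \in O \/ x^-1 \in O.
Notation small := (small O).

Lemma small0 : small 0. Proof. by rewrite /small eqxx. Qed.

Lemma smallW x : small x -> x \in O.
Proof. by case/orP => [/eqP->|]; [exact: rpred0|case: (valO x) => // ->]. Qed.

Lemma smallMl a x : a \in O -> small x -> small (a * x).
Proof.
move=> Oa sx; have [->|ax0] := eqVneq (a * x) 0; first exact: small0.
move: (ax0); rewrite mulf_eq0 negb_or => /andP[a0 x0].
apply/orP; right; apply: contraL sx => Oax; rewrite /small (negPf x0) /= negbK.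
have -> : x^-1 = a * (a * x)^-1 by field; rewrite a0 x0.
exact: rpredM.
Qed.

Lemma smallMr a x : a \in O -> small x -> small (x * a).
Proof. by rewrite mulrC; apply: smallMl. Qed.

Lemma smallN x : small x -> small (- x).
Proof. by move=> sx; rewrite -mulN1r smallMl // rpredN1. Qed.

Lemma smallD x y : small x -> small y -> small (x + y).
Proof.
move=> sx sy; have [->|x0] := eqVneq x 0; first by rewrite add0r.
have [->|y0] := eqVneq y 0; first by rewrite addr0.
have [Oxy|] := valO (x / y).
  have -> : x + y = (x / y + 1) * y by field.
  by rewrite smallMl // rpredD ?rpred1.
rewrite invf_div => Oyx; have -> : x + y = (y / x + 1) * x by field.
by rewrite smallMl // rpredD ?rpred1.
Qed.

Lemma smallB x y : small x -> small y -> small (x - y).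
Proof. by move=> sx sy; rewrite smallD ?smallN. Qed.

Lemma small1F : small 1 = false.
Proof. by rewrite /small oner_eq0 invr1 rpred1. Qed.

Lemma small_sqr x : small (x ^+ 2) -> small x.
Proof.
apply: contraLR; rewrite /small !negb_or !negbK sqrf_eq0 => /andP[-> Ox'].
by rewrite -exprVn rpredX.
Qed.

Lemma smallV x : x \notin O -> small x^-1.
Proof. by move=> Ox; rewrite /small invrK Ox orbT. Qed.

Definition vunit : {pred K} := fun x => (x \in O) && ~~ small x.

Lemma vunitP x : reflect [/\ x != 0, x \in O & x^-1 \in O] (vunit x).
Proof.
rewrite /vunit /small negb_or negbK.
by apply: (iffP and3P) => -[].
Qed.

Lemma vunitM x y : vunit x -> vunit y -> vunit (x * y).
Proof.
move=> /vunitP[x0 Ox Ox'] /vunitP[y0 Oy Oy']; apply/vunitP.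
by rewrite mulf_neq0 ?invfM ?rpredM.
Qed.

Lemma vunitV x : vunit x -> vunit x^-1.
Proof. by move=> /vunitP[x0 Ox Ox']; apply/vunitP; rewrite invr_eq0 invrK. Qed.

Lemma vunitX x n : vunit x -> vunit (x ^+ n).
Proof.
by move=> /vunitP[x0 Ox Ox']; apply/vunitP; rewrite expf_neq0 -?exprVn ?rpredX.
Qed.

Lemma vunitN x : vunit x -> vunit (- x).
Proof. by move=> /vunitP[x0 Ox Ox']; apply/vunitP; rewrite oppr_eq0 invrN !rpredN. Qed.

Lemma vunitD x y : vunit x -> small y -> vunit (x + y).
Proof.
move=> /andP[Ox sx] sy; apply/andP; split; first by rewrite rpredD ?(smallW sy).
by apply: contra sx => sxy; rewrite -[x](addrK y) smallB.
Qed.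

Lemma vunit_sqr x : vunit (x ^+ 2) -> vunit x.
Proof.
move=> /vunitP[]; rewrite sqrf_eq0 => x0 Ox Ox'; apply/vunitP; split=> //.
  case: (valO x) => // O1; have -> : x = x ^+ 2 * x^-1 by field.
  exact: rpredM.
case: (valO x) => // O1; have -> : x^-1 = x * (x ^+ 2)^-1 by field.
exact: rpredM.
Qed.

End SmallElements.

Ltac memO := first
  [ assumption | exact: rpred1 | exact: rpred_nat
  | (first [apply: rpredM | apply: rpredX | apply: rpredN | apply: rpredB | apply: rpredD]);
    memO ].

(** * Collinear points and the chord-and-tangent law *)

Definition wneg (F : fieldType) (P : wpoint F) : wpoint F :=
  if P is Affine x y then Affine x (- y) else Infinity.

Lemma wnegK (F : fieldType) : involutive (@wneg F).
Proof. by case=> //= x y; rewrite opprK. Qed.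

(** The line [y = s x + c] meets the curve exactly in three points, counted with
    multiplicity: the last three equations compare the coefficients of
    [x^3 + A x + B - (s x + c)^2] and of [(x - x1) (x - x2) (x - x3)].
    Chords and tangents are thus treated together, and the relation is visibly
    symmetric in the three points. *)
Definition collinear (F : fieldType) (A B x1 y1 x2 y2 x3 y3 : F) : Prop :=
  exists s c : F,
    [/\ y1 = s * x1 + c, y2 = s * x2 + c & y3 = s * x3 + c] /\
    [/\ x1 + x2 + x3 = s ^+ 2,
        x1 * x2 + x1 * x3 + x2 * x3 = A - 2 * s * c
      & x1 * x2 * x3 = c ^+ 2 - B].

Section Chords.
Variables (F : fieldType) (A B : F).
Hypothesis two_neq0 : 2 != 0 :> F.

Lemma oppr_fixed (y : F) : y = - y -> y = 0.
Proof.
move=> yN; apply/eqP; have /eqP : 2 * y = 0 by rewrite mulr_natl mulr2n {2}yN subrr.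
by rewrite mulf_eq0 (negPf two_neq0).
Qed.

(** The equation on [A] is the difference of the two curve equations divided by
    [x2 - x1]; for [x1 = x2] it says that [s] is the slope of the tangent. *)
Lemma collinear_of_slope (x1 y1 x2 y2 s : F) :
    on_curve A B (Affine x1 y1) ->
    y2 - y1 = s * (x2 - x1) ->
    x1 ^+ 2 + x1 * x2 + x2 ^+ 2 + A = s * (y1 + y2) ->
  let x3 := s ^+ 2 - x1 - x2 in
  collinear A B x1 y1 x2 y2 x3 (- (s * (x1 - x3) - y1)).
Proof.
move=> /= E1 Es EA; exists s, (y1 - s * x1).
have -> : y2 = y1 + s * (x2 - x1) by rewrite -Es; ring.
have EB : B = y1 ^+ 2 - x1 ^+ 3 - A * x1 by rewrite E1; ring.
have {}EA : A = s * (y1 + y2) - (x1 ^+ 2 + x1 * x2 + x2 ^+ 2) by rewrite -EA; ring.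
have Ey : y2 = y1 + s * (x2 - x1) by rewrite -Es; ring.
by split; split; rewrite ?EB ?EA ?Ey; ring.
Qed.

Lemma wadd_collinear (x1 y1 x2 y2 x3 y3 : F) :
    on_curve A B (Affine x1 y1) -> on_curve A B (Affine x2 y2) ->
    wadd A (Affine x1 y1) (Affine x2 y2) = Affine x3 y3 ->
  collinear A B x1 y1 x2 y2 x3 (- y3).
Proof.
move=> E1 E2 /=; case: ifPn => [x12|/negPn/eqP x12].
  case=> <- <-; apply: collinear_of_slope => //.
    by field; rewrite subr_eq0 eq_sym.
  have x21 : x2 - x1 != 0 by rewrite subr_eq0 eq_sym.
  apply: (mulfI x21); transitivity (y2 ^+ 2 - y1 ^+ 2); last by field.
  by rewrite E1 E2; ring.
case: eqP => // y12; case=> <- <-.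
have y21 : y2 = y1.
  have /eqP : (y1 - y2) * (y1 + y2) = 0.
    by rewrite -subr_sqr E1 E2 x12 subrr.
  by rewrite mulf_eq0 subr_eq0 addr_eq0 => /orP[/eqP-> //|/eqP/y12].
have y0 : y1 != 0.
  by apply: contra_notN y12 => /eqP y10; rewrite y21 y10 oppr0.
apply: collinear_of_slope => //; first by rewrite y21 x12; ring.
by rewrite y21 -x12; field; rewrite y0 two_neq0.
Qed.

Lemma collinear_on_curve (x1 y1 x2 y2 x3 y3 : F) :
  collinear A B x1 y1 x2 y2 x3 y3 -> on_curve A B (Affine x3 y3).
Proof.
move=> [s [c [[_ _ ->] [e1 e2 e3]]]] /=.
have -> : B = c ^+ 2 - x1 * x2 * x3 by rewrite e3; ring.
have -> : A = x1 * x2 + x1 * x3 + x2 * x3 + 2 * s * c by rewrite e2; ring.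
have -> : (s * x3 + c) ^+ 2 = s ^+ 2 * x3 ^+ 2 + 2 * s * c * x3 + c ^+ 2 by ring.
by rewrite -e1; ring.
Qed.

Lemma collinear_wadd (x1 y1 x2 y2 x3 y3 : F) :
    collinear A B x1 y1 x2 y2 x3 y3 -> ~ (x1 = x2 /\ y1 = - y2) ->
  wadd A (Affine x1 y1) (Affine x2 y2) = Affine x3 (- y3).
Proof.
move=> [s [c [[E1 E2 E3] [e1 e2 e3]]]] ndeg /=.
have x3E : x3 = s ^+ 2 - x1 - x2 by rewrite -e1; ring.
suff chordE : chord x1 y1 x2 s = Affine x3 (- y3).
  case: ifPn => [x12|/negPn/eqP x12].
    rewrite -chordE; congr chord; rewrite E1 E2; field.
    by rewrite subr_eq0 eq_sym.
  case: eqP => [y12|_]; first by case: ndeg.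
  have y12 : y2 = y1 by rewrite E1 E2 x12.
  have y0 : y1 != 0.
    by apply: contra_notN ndeg => /eqP y10; rewrite y12 y10 oppr0.
  rewrite -chordE; congr chord.
  have EA : A = x1 * x2 + x1 * x3 + x2 * x3 + 2 * s * c by rewrite e2; ring.
  have Ec : c = y1 - s * x1 by rewrite E1; ring.
  by rewrite EA x3E Ec -x12; field; rewrite y0 two_neq0.
by rewrite /chord -x3E E1 E3; congr Affine; ring.
Qed.

Lemma collinear_rot (x1 y1 x2 y2 x3 y3 : F) :
  collinear A B x1 y1 x2 y2 x3 y3 -> collinear A B x1 y1 x3 y3 x2 y2.
Proof.
move=> [s [c [[E1 E2 E3] [e1 e2 e3]]]]; exists s, c.
by split; split=> //; rewrite -?e1 -?e2 -?e3; ring.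
Qed.

(** Eliminating [s] and [c] from the coefficient equations: both sides equal
    [4 s^2 c^2]. *)
Lemma collinear_abscissas (x1 y1 x2 y2 x3 y3 : F) :
    collinear A B x1 y1 x2 y2 x3 y3 ->
  (x1 * x2 + x1 * x3 + x2 * x3 - A) ^+ 2 =
    4 * (x1 + x2 + x3) * (x1 * x2 * x3 + B).
Proof. by move=> [s [c [_ [-> -> ->]]]]; ring. Qed.

End Chords.

(** The two points determine the third root [- (a + b)] of the cubic. *)
Lemma two_torsion_coefficients (F : fieldType) (A B a b : F) :
    on_curve A B (Affine a 0) -> on_curve A B (Affine b 0) -> a != b ->
  A = - (a ^+ 2 + a * b + b ^+ 2) /\ B = a * b * (a + b).
Proof.
rewrite /= !expr0n /= => Ea Eb ab.
have AE : A = - (a ^+ 2 + a * b + b ^+ 2).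
  have d0 : a - b != 0 by rewrite subr_eq0.
  apply: (mulfI d0); apply/eqP; rewrite -subr_eq0; apply/eqP.
  transitivity ((a ^+ 3 + A * a + B) - (b ^+ 3 + A * b + B)); first by ring.
  by rewrite -Ea -Eb subrr.
split=> //; have -> : B = (a ^+ 3 + A * a + B) - a ^+ 3 - A * a by ring.
by rewrite -Ea AE; ring.
Qed.

(** * The sequence of multiples of a point *)

Section Multiples.
Variables (F : fieldType) (A B x y : F).
Hypothesis two_neq0 : 2 != 0 :> F.
Hypothesis curveP : on_curve A B (Affine x y).
Hypothesis y_neq0 : y != 0.
Notation P := (Affine x y).
Notation Q k := (wmuln A k P).

Lemma wmuln_on_curve k : on_curve A B (Q k).
Proof.
elim: k => // k; rewrite /wmuln iterS -/(wmuln A k P).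
case EQ : (Q k) => [|x1 y1] // E1; case E : (wadd _ _ _) => [|x3 y3] //.
have := collinear_on_curve (wadd_collinear two_neq0 curveP E1 E).
by rewrite /= sqrrN.
Qed.

(** This instance [Z = (P + Z) - P] of associativity comes from reading the same
    three collinear points in another order; [y != 0] excludes the case where
    the line is the vertical tangent at [P]. *)
Lemma wadd_cancel Z : on_curve A B Z ->
  Z = wneg (wadd A P (wneg (wadd A P Z))).
Proof.
case: Z => [_|x1 y1 E1]; first by rewrite /= eqxx opprK eqxx.
case E : (wadd A P (Affine x1 y1)) => [|x3 y3].
  move: E => /=; case: ifP => [//|/negbFE/eqP <-].
  by case: eqP => // ->; rewrite opprK.
have col := wadd_collinear two_neq0 curveP E1 E.
rewrite /= -/(wadd A P (Affine x3 (- y3))).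
rewrite (collinear_wadd two_neq0 (collinear_rot col)) /= ?opprK // => -[xx yy].
have [s [c [[y_ _ y3_] _]]] := col.
case/negP: y_neq0; apply/eqP; apply: (oppr_fixed two_neq0).
by rewrite {1}y_ xx -y3_ -yy.
Qed.

(** By cancellation, each step back from [n P = O] is the opposite of the
    corresponding step forward from [0 P]. *)
Lemma wmuln_reflect n k : Q n = Infinity -> (k <= n)%N -> Q (n - k) = wneg (Q k).
Proof.
move=> Qn; elim: k => [|k IH] kn; first by rewrite subn0 Qn.
have := wadd_cancel (wmuln_on_curve (n - k.+1)).
rewrite -[wadd A P (Q _)]/(Q (n - k.+1).+1) subnSK // IH ?(ltnW kn) // => ->.
by rewrite wnegK.
Qed.

Definition abscissa (P : wpoint F) : F := if P is Affine x1 _ then x1 else 0.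

Definition gap k : F := x - abscissa (Q k).

(** The third division polynomial at [x]; the second one is [2 y]. *)
Definition psi3 : F := 3 * x ^+ 4 + 6 * A * x ^+ 2 + 12 * B * x - A ^+ 2.

(** [xp] and [xm] are the abscissas of [R + P] and [R - P], for [R] the point
    with coordinates [x1] and [y1]. *)
Lemma chord_gaps (x1 y1 : F) : on_curve A B (Affine x1 y1) -> x1 != x ->
  let xp := ((y1 - y) / (x1 - x)) ^+ 2 - x - x1 in
  let xm := ((y1 + y) / (x1 - x)) ^+ 2 - x - x1 in
  (x - xp) * (x - xm) * (x - x1) ^+ 2 = 4 * y ^+ 2 * (x - x1) - psi3.
Proof.
move=> /= E1 x1x; have d0 : x1 - x != 0 by rewrite subr_eq0.
have BE : B = y ^+ 2 - x ^+ 3 - A * x by move: curveP => /= ->; ring.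
have AE : A = (y1 ^+ 2 - y ^+ 2) / (x1 - x) - (x1 ^+ 2 + x1 * x + x ^+ 2).
  by rewrite E1 (curveP : _ = _); field.
by rewrite /psi3 BE AE; field.
Qed.

(** With [gap n = psi_(n+1) psi_(n-1) / psi_n^2], this is the recurrence
    [psi_(n+2) psi_(n-2) = psi_2^2 psi_(n+1) psi_(n-1) - psi_3 psi_n^2] of the
    division polynomials. *)
Lemma gap_recurrence k :
    Q k <> Infinity -> Q k.+1 <> Infinity -> Q k.+2 <> Infinity ->
    gap k.+1 != 0 ->
  gap k.+2 * gap k * gap k.+1 ^+ 2 = 4 * y ^+ 2 * gap k.+1 - psi3.
Proof.
rewrite /gap; have := wmuln_on_curve k.+1; have := wmuln_on_curve k.
have E1 : Q k.+1 = wadd A P (Q k) by []; have E2 : Q k.+2 = wadd A P (Q k.+1) by [].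
case E0 : (Q k) E1 => [//|x0 y0]; case: (Q k.+1) E2 => [//|x1 y1].
move=> E2 E1 on0 on1 _ _ _; rewrite E2 subr_eq0 /= => x1x; rewrite x1x /=.
move: x1x; rewrite eq_sym => x1x.
rewrite -(chord_gaps on1 x1x); congr (_ * (x - _) * _).
have [s [c [[e1 _ e3] [e _ _]]]] := wadd_collinear two_neq0 curveP on0 (esym E1).
have -> : x0 = s ^+ 2 - x - x1 by rewrite -e; ring.
have -> : s = - (y1 + y) / (x1 - x); last by rewrite mulNr sqrrN.
apply: (canRL (mulfK _)); first by rewrite subr_eq0.
by rewrite opprD e3 {1}e1; ring.
Qed.

End Multiples.

(** * Points with nonsingular reduction have infinite order *)

Section Reduction.
Variables (K : fieldType) (O : subringClosed K).
Hypothesis valO : forall x, x \in O \/ x^-1 \in O.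
Notation small := (small O).
Notation vunit := (vunit O).
Variables A B x : K.
Hypotheses (OA : A \in O) (OB : B \in O) (Ox : x \in O).
Hypothesis small2 : small 2.

Let small2M a : a \in O -> small (2 * a).
Proof. by move=> Oa; rewrite mulrC smallMl. Qed.

(** Modulo small elements [2 = 0] and [x1 = x]; an integral [x3] would then turn
    the relation into [(x^2 - A)^2 = 0]. *)
Lemma abscissa_near_point (x1 x3 : K) : ~~ small (x ^+ 2 + A) ->
    small (x1 - x) ->
    (x * x1 + x * x3 + x1 * x3 - A) ^+ 2 =
      4 * (x + x1 + x3) * (x * x1 * x3 + B) ->
  x3 \notin O.
Proof.
move=> nsm sd G; apply: contra nsm => Ox3.
have Ox1 : x1 \in O by rewrite -[x1](subrK x) rpredD // (smallW valO).
have sE : small (x * x1 + x * x3 + x1 * x3 - A).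
  apply: small_sqr; rewrite G (_ : 4 = 2 * 2); last by ring.
  rewrite -!mulrA; apply: small2M; memO.
have -> : x ^+ 2 + A = - (x * x1 + x * x3 + x1 * x3 - A) + (x + x3) * (x1 - x)
    + 2 * (x * (x + x3)) by ring.
apply: smallD => //; last by apply: small2M; memO.
apply: smallD => //; first exact: smallN.
by apply: smallMl => //; memO.
Qed.

(** Divided by [x1 ^+ 2], the relation becomes [(x + x3)^2 = 0] modulo small
    elements when [x3] is integral; dividing also by [x3 ^+ 2] when it is not
    gives [1 = 0]. *)
Lemma abscissa_near_infinity (x1 x3 : K) : x1 \notin O ->
    (x * x1 + x * x3 + x1 * x3 - A) ^+ 2 =
      4 * (x + x1 + x3) * (x * x1 * x3 + B) ->
  small (x3 - x).
Proof.
move=> Ox1 G; have sr := smallV Ox1; set r := x1^-1 in sr.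
have x10 : x1 != 0 by apply: contraNneq Ox1 => ->; rewrite rpred0.
have Or := smallW valO sr.
have [Ox3|/negP Ox3] := pselect (x3 \in O).
  have sE : small (x + x3 + r * (x * x3 - A)).
    apply: small_sqr.
    have -> : (x + x3 + r * (x * x3 - A)) ^+ 2 =
        2 * (2 * (1 + r * (x + x3)) * (x * x3 + r * B)).
      apply: (mulfI (expf_neq0 2 x10)); rewrite -exprMn.
      transitivity ((x * x1 + x * x3 + x1 * x3 - A) ^+ 2).
        by congr (_ ^+ 2); rewrite /r; field.
      by rewrite G /r; field.
    by apply: small2M; memO.
  have -> : x3 - x = (x + x3 + r * (x * x3 - A)) - (x * x3 - A) * r - 2 * x by ring.
  apply: smallB => //; last by apply: small2M; memO.
  by apply: smallB => //; apply: smallMl => //; memO.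
have sq := smallV Ox3; set q := x3^-1 in sq.
have x30 : x3 != 0 by apply: contraNneq Ox3 => ->; rewrite rpred0.
have Oq := smallW valO sq.
have E : (1 + (q * x + r * (x - A * q))) ^+ 2 =
    2 * (2 * (q + r * (x * q + 1)) * (x + r * B * q)).
  apply: (mulfI (expf_neq0 2 (mulf_neq0 x10 x30))); rewrite -exprMn.
  transitivity ((x * x1 + x * x3 + x1 * x3 - A) ^+ 2).
    by congr (_ ^+ 2); rewrite /r /q; field; rewrite x10 x30.
  by rewrite G /r /q; field; rewrite x10 x30.
have : small ((1 + (q * x + r * (x - A * q))) ^+ 2).
  by rewrite E small2M // !(rpredM, rpredD) ?rpred1.
move=> /small_sqr s1.
suff : small 1 by rewrite small1F.
rewrite -(addrK (q * x + r * (x - A * q)) 1) smallB // smallD ?smallMr //; memO.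
Qed.

(** Modulo [2], [psi3] is [- (x^2 + A)^2]. *)
Lemma vunit_psi3 : ~~ small (x ^+ 2 + A) -> vunit (psi3 A B x).
Proof.
move=> nsm; have -> : psi3 A B x =
    - (x ^+ 2 + A) ^+ 2 + 2 * (2 * x ^+ 4 + 4 * A * x ^+ 2 + 6 * B * x).
  by rewrite /psi3; ring.
apply: vunitD => //; last by apply: small2M; memO.
by apply/vunitN/vunitX; rewrite /vunit nsm andbT; memO.
Qed.

Variable y : K.
Hypothesis two_neq0 : 2 != 0 :> K.
Hypothesis curveP : on_curve A B (Affine x y).
Hypothesis y_neq0 : y != 0.
Hypothesis nonsing : ~~ small (x ^+ 2 + A).
Notation P := (Affine x y).
Notation Q k := (wmuln A k P).

Definition near_infinity (R : wpoint K) : Prop :=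
  if R is Affine x1 _ then x1 \notin O else True.

Definition near_point (R : wpoint K) : Prop :=
  if R is Affine x1 _ then small (x1 - x) else False.

Lemma wadd_near_infinity R : on_curve A B R ->
  near_infinity R -> near_point (wadd A P R).
Proof.
case: R => [_ _|x1 y1 onR Ox1]; first by rewrite /= subrr small0.
case E : (wadd _ _ _) => [|x3 y3].
  by move: E Ox1 => /=; case: eqP => [<-|//]; rewrite Ox.
have := collinear_abscissas (wadd_collinear two_neq0 curveP onR E).
exact: abscissa_near_infinity.
Qed.

Lemma wadd_near_point R : on_curve A B R ->
  near_point R -> near_infinity (wadd A P R).
Proof.
case: R => [//|x1 y1 onR sd].
case E : (wadd _ _ _) => [//|x3 y3].
have := collinear_abscissas (wadd_collinear two_neq0 curveP onR E).
exact: abscissa_near_point.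
Qed.

(** The reduction of the curve modulo [small] is cuspidal, and its smooth points
    form an additive group of characteristic two. Hence the multiples of [P]
    reduce alternately to the origin and to the reduction of [P]. *)
Lemma wmuln_near k :
  if odd k then near_point (Q k) else near_infinity (Q k).
Proof.
elim: k => [//|k]; rewrite oddS -[Q k.+1]/(wadd A P (Q k)).
have on := wmuln_on_curve two_neq0 curveP k.
by case: (odd k); [exact: wadd_near_point|exact: wadd_near_infinity].
Qed.

(** Here [Q m + k P] plays the role of [k S] or of [k S + T], for [T = Q m] of
    order two and [S = P + T] in the kernel of reduction, which has no odd
    torsion. Concretely, with [e = x - t], the recurrence shows that the gaps of
    the points [Q m + k P] are units times [e] for [k] even and units times
    [e^-1] for [k] odd. The gap of [Q (2 m - 1) = - P] vanishes, so it would
    have to be a unit times [e], which is not [0]. *)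
Lemma order_not_twice_odd m t : odd m -> Q m = Affine t 0 ->
    (forall k, (0 < k < m.*2)%N -> Q k <> Infinity) ->
  Q m.*2 <> Infinity.
Proof.
move=> oddm Qm Qaff Q2m; set D := gap A x y; pose e := x - t.
have m_gt0 : (0 < m)%N by case: (m) oddm.
have D0 : D m = e by rewrite /D /gap Qm.
have ont := wmuln_on_curve two_neq0 curveP m; rewrite Qm /= expr0n /= in ont.
have e0 : e != 0.
  rewrite subr_eq0; apply: contraNneq y_neq0 => xt.
  by rewrite -sqrf_eq0 curveP xt -ont.
have se : small e.
  by have := wmuln_near m; rewrite oddm Qm /= => /smallN; rewrite opprB.
have Ot : t \in O.
  by rewrite -[t](subKr x) rpredB // (smallW valO).
pose g := x ^+ 2 + x * t + t ^+ 2 + A.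
have Og : g \in O by rewrite /g; memO.
have y2 : y ^+ 2 = e * g.
  transitivity ((x ^+ 3 + A * x + B) - (t ^+ 3 + A * t + B)); last by rewrite /e /g; ring.
  by rewrite -ont subr0.
have psiU := vunit_psi3 nonsing.
have rhsU z : small z -> vunit (z - psi3 A B x).
  by move=> sz; rewrite addrC vunitD ?vunitN.
have rec k : (0 < k)%N -> (k.+2 < m.*2)%N -> D k.+1 != 0 ->
    D k.+2 * D k * D k.+1 ^+ 2 = 4 * y ^+ 2 * D k.+1 - psi3 A B x.
  by move=> k0 k2; apply: gap_recurrence => //; apply: Qaff; clear -k0 k2; lia.
have claim k : (m + k.*2 < m.*2)%N -> vunit (D (m + k.*2)%N / e) /\
    (((m + k.*2).+1 < m.*2)%N -> vunit (D (m + k.*2).+1%N * e)).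
  elim: k => [|k IH] lt_k.
    rewrite addn0 D0 divff //; split=> [|m1].
      by apply/vunitP; rewrite invr1 rpred1 oner_neq0.
    (* [T + P] and [T - P] are opposite, so the chord identity gives a square *)
    have -> : D m.+1 = x - ((y / e) ^+ 2 - x - t).
      rewrite /D /gap -[Q m.+1]/(wadd A P (Q m)) Qm /= -subr_eq0 -/e e0 /=.
      by rewrite sub0r -[t - x]opprB -/e invrN mulrNN.
    apply: vunit_sqr => //.
    have tx : t != x by rewrite eq_sym -subr_eq0.
    have ont' : on_curve A B (Affine t 0) by rewrite /= expr0n.
    have /= := chord_gaps curveP ont' tx; rewrite !add0r mulNr sqrrN.
    have -> : (y / (t - x)) ^+ 2 = (y / e) ^+ 2.
      by rewrite -[t - x]opprB -/e invrN mulrN sqrrN.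
    rewrite -/e -expr2 -exprMn => ->; apply: rhsU; rewrite y2.
    have -> : 4 * (e * g) * e = (4 * g * e) * e by ring.
    by apply: smallMl => //; have Oe := smallW valO se; memO.
  have [] := IH; first by clear -lt_k; lia.
  rewrite doubleS !addnS in lt_k *; set a := (m + k.*2)%N in lt_k *.
  move=> U1 /(_ (ltnW lt_k)) U2.
  have Da0 : D a != 0 by case/vunitP: U1; rewrite mulf_eq0 negb_or => /andP[].
  have Da1 : D a.+1 != 0 by case/vunitP: U2; rewrite mulf_eq0 negb_or => /andP[].
  have U3 : vunit (D a.+2 / e).
    have Ur : vunit (4 * y ^+ 2 * D a.+1 - psi3 A B x).
      apply: rhsU; rewrite y2 (_ : _ * _ = 2 * (2 * g * (D a.+1 * e))); last by ring.
      by have /vunitP[_ OD _] := U2; apply: small2M; memO.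
    have Dr := rec a _ lt_k Da1; rewrite -Dr in Ur; last by clear -m_gt0; lia.
    have -> : D a.+2 / e = D a.+2 * D a * D a.+1 ^+ 2 / (D a / e * (D a.+1 * e) ^+ 2).
      by field; rewrite e0 Da0 Da1.
    by apply: vunitM => //; apply/vunitV/vunitM => //; apply: vunitX.
  split=> // lt_k'.
  have Da2 : D a.+2 != 0 by case/vunitP: U3; rewrite mulf_eq0 negb_or => /andP[].
  have Ur : vunit (4 * y ^+ 2 * D a.+2 - psi3 A B x).
    apply: rhsU; rewrite (_ : _ * _ = (4 * y ^+ 2 * (D a.+2 / e)) * e); last by field.
    have /vunitP[_ OD _] := U3; apply: smallMl => //; rewrite y2.
    by have Oe := smallW valO se; memO.
  rewrite -rec // in Ur.
  have -> : D a.+3 * e =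
      D a.+3 * D a.+1 * D a.+2 ^+ 2 / (D a.+1 * e * (D a.+2 / e) ^+ 2).
    by field; rewrite e0 Da2 Da1.
  by apply: vunitM => //; apply/vunitV/vunitM => //; apply: vunitX.
have Qlast : Q m.*2.-1 = Affine x (- y).
  rewrite -subn1 (wmuln_reflect two_neq0 curveP y_neq0 Q2m) //.
  by rewrite double_gt0.
have [] := claim m./2; first by clear -oddm m_gt0; lia.
rewrite (_ : m + _ = m.*2.-1)%N; last by clear -oddm m_gt0; lia.
by rewrite /D /gap Qlast /= subrr mul0r => /vunitP[]; rewrite eqxx.
Qed.

(** Let [N] be the order of [P]. It is even since odd multiples stay near [P].
    Then [Q (N / 2)] is its own opposite, hence of order two. For [N / 2] even
    its abscissa is not integral, although it is a root of the monic cubic. *)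
Theorem nonsingular_reduction_not_torsion : ~ is_torsion A P.
Proof.
move=> [n n0 Qn].
have [N QN minN] : exists2 N, (0 < N)%N /\ Q N = Infinity &
    forall k, (0 < k < N)%N -> Q k <> Infinity.
  have ex : exists k, (0 < k)%N && `[< Q k = Infinity >].
    by exists n; rewrite n0; apply/asboolP.
  case: (ex_minnP ex) => N /andP[N0 /asboolP QN] minN; exists N => // k /andP[k0 kN] Qk.
  by have := minN k; rewrite k0 leqNgt kN => /(_ (asboolT Qk)).
case: QN => N0 QN.
have [oddN|evenN] := boolP (odd N); first by have := wmuln_near N; rewrite oddN QN.
have NE : N = (N./2).*2 by clear -evenN; lia.
set m := N./2 in NE; have m0 : (0 < m)%N by clear -NE N0; lia.
have Qm := wmuln_reflect two_neq0 curveP y_neq0 QN (_ : (m <= N)%N).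
have {Qm} : Q m = wneg (Q m) by rewrite -Qm ?NE -?addnn ?addnK ?leq_addr.
have on := wmuln_on_curve two_neq0 curveP m.
have := wmuln_near m.
case EQ : (Q m) on => [|t v] on near; first by case: (minN m) => //; clear -NE m0; lia.
case=> /(oppr_fixed two_neq0) v0; rewrite v0 in EQ on near.
move: near; case: ifP => [oddm _|_ /= Ot].
  apply: (order_not_twice_odd oddm EQ) => [k|]; rewrite -NE //; exact: minN.
have t0 : t != 0 by apply: contraNneq Ot => ->; rewrite rpred0.
have sr := smallV Ot; have Or := smallW valO sr.
suff : small 1 by rewrite small1F.
have -> : 1 = - (t^-1 * (A * t^-1 + B * t^-1 ^+ 2)).
  rewrite /= expr0n /= in on; apply: (mulfI (expf_neq0 3 t0)).
  apply/eqP; rewrite -subr_eq0 [X in _ == X]on; apply/eqP; field; exact: t0.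
by rewrite smallN ?smallMr //; memO.
Qed.

End Reduction.

(** * Rescaling the curve *)

Definition wscale (F : fieldType) (l : F) (P : wpoint F) : wpoint F :=
  if P is Affine x y then Affine (l ^+ 2 * x) (l ^+ 3 * y) else Infinity.

Section Scaling.
Variables (F : fieldType) (l A B : F).
Hypothesis l_neq0 : l != 0.

Lemma wscale_on_curve P :
  on_curve A B P -> on_curve (l ^+ 4 * A) (l ^+ 6 * B) (wscale l P).
Proof. by case: P => //= x y E; rewrite exprMn E; ring. Qed.

Lemma wscale_chord (x1 y1 x2 s : F) :
  wscale l (chord x1 y1 x2 s) =
  chord (l ^+ 2 * x1) (l ^+ 3 * y1) (l ^+ 2 * x2) (l * s).
Proof. by rewrite /chord /=; congr Affine; ring. Qed.

Lemma wscale_wadd P Q :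
  wscale l (wadd A P Q) = wadd (l ^+ 4 * A) (wscale l P) (wscale l Q).
Proof.
case: P Q => [//|x1 y1] [//|x2 y2] /=.
have -> : (l ^+ 2 * x1 != l ^+ 2 * x2) = (x1 != x2).
  by rewrite (inj_eq (mulfI (expf_neq0 _ l_neq0))).
have -> : (l ^+ 3 * y1 == - (l ^+ 3 * y2)) = (y1 == - y2).
  by rewrite -mulrN (inj_eq (mulfI (expf_neq0 _ l_neq0))).
case: ifPn => [x12|_].
  rewrite wscale_chord; congr chord; field.
  by rewrite -mulrBr mulf_neq0 ?expf_neq0 //= !subr_eq0 eq_sym x12.
case: eqP => [//|_]; rewrite wscale_chord; congr chord.
have [y0|y0] := eqVneq (2 * y1) 0.
  by rewrite (mulrCA 2 (l ^+ 3)) y0 !mulr0 invr0 !mulr0.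
rewrite (mulrCA 2 (l ^+ 3)); move: (2 * y1) y0 => d d0.
by field; rewrite l_neq0 d0.
Qed.

Lemma wscale_torsion P : is_torsion A P -> is_torsion (l ^+ 4 * A) (wscale l P).
Proof.
move=> [n n0 nP]; exists n => //.
suff -> : wmuln (l ^+ 4 * A) n (wscale l P) = wscale l (wmuln A n P) by rewrite nP.
by rewrite /wmuln; elim: n {n0 nP} => //= n ->; rewrite wscale_wadd.
Qed.

End Scaling.

(** * Torsion points reduce to the cusp *)

Section SmallTorsion.
Variables (K : closedFieldType) (O : subringClosed K).
Hypothesis valO : forall x, x \in O \/ x^-1 \in O.
Hypotheses (two_neq0 : 2 != 0 :> K) (small2 : small O 2).

Lemma fourth_root (a : K) : exists l : K, l ^+ 4 = a.
Proof.
have [l lE] := @solve_monicpoly K 4 (fun i => if i == 0%N then a else 0) isT.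
exists l; rewrite lE !big_ord_recl big_ord0 /= expr0 mulr1.
by rewrite !mul0r !addr0.
Qed.

(** Modulo a prime above [2] the partial derivatives of the curve equation vanish
    exactly where [x^2 + A = 0], so [P] reduces to the cusp. If [A] is not
    integral, rescaling by a fourth root of [A^-1] gives [A = 1] and makes
    [x] and [B] small, hence a nonsingular reduction again. *)
Lemma torsion_reduces_to_cusp (A B x y : K) :
    B \in O -> x \in O -> on_curve A B (Affine x y) -> y != 0 ->
    is_torsion A (Affine x y) ->
  A \in O /\ small O (x ^+ 2 + A).
Proof.
move=> OB Ox onP y0 tors.
have [OA|/negP OA] := pselect (A \in O).
  split=> //; apply: contraT => nonsing.
  by case: (nonsingular_reduction_not_torsion valO OA OB Ox small2 two_neq0 onP y0
    nonsing).
exfalso; have [l lA] := fourth_root A^-1.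
have A0 : A != 0 by apply: contraNneq OA => ->; rewrite rpred0.
have l0 : l != 0 by apply: contraNneq A0 => l0; rewrite -invr_eq0 -lA l0 expr0n.
have sl : small O l.
  by do 2!apply: small_sqr; rewrite -exprM lA smallV.
have Ol := smallW valO sl.
have A1 : l ^+ 4 * A = 1 by rewrite lA mulVf.
have O1 : l ^+ 4 * A \in O by rewrite A1 rpred1.
have OB' : l ^+ 6 * B \in O by memO.
have Ox' : l ^+ 2 * x \in O by memO.
have y0' : l ^+ 3 * y != 0 by rewrite mulf_neq0 ?expf_neq0.
apply: (nonsingular_reduction_not_torsion valO O1 OB' Ox' small2 two_neq0 _ y0' _ _).
- exact: (wscale_on_curve l onP).
- have sx : small O ((l ^+ 2 * x) ^+ 2).
    have -> : (l ^+ 2 * x) ^+ 2 = (l ^+ 3 * x ^+ 2) * l by ring.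
    by apply: smallMl => //; memO.
  rewrite A1; apply/negP => s1.
  suff : small O 1 by rewrite small1F.
  by rewrite -(addKr ((l ^+ 2 * x) ^+ 2) 1) smallD ?smallN.
- exact: (wscale_torsion l0 tors).
Qed.

(** The Frobenius map is injective on the residue field, so the square of the
    abscissa of the cusp determines that abscissa. *)
Lemma torsion_abscissas_collide (A B a1 y1 a2 y2 : K) :
    B \in O -> a1 \in O -> a2 \in O ->
    on_curve A B (Affine a1 y1) -> is_torsion A (Affine a1 y1) -> y1 != 0 ->
    on_curve A B (Affine a2 y2) -> is_torsion A (Affine a2 y2) -> y2 != 0 ->
  small O (a1 - a2).
Proof.
move=> OB O1 O2 on1 t1 y10 on2 t2 y20.
have [OA s1] := torsion_reduces_to_cusp OB O1 on1 y10 t1.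
have [_ s2] := torsion_reduces_to_cusp OB O2 on2 y20 t2.
apply: small_sqr.
have -> : (a1 - a2) ^+ 2 = (a1 ^+ 2 + A) - (a2 ^+ 2 + A) - (a2 * (a1 - a2)) * 2 by ring.
by apply: smallB => //; [exact: smallB|apply: smallMl => //; memO].
Qed.

Lemma torsion_pair (A B a b : K) :
    B \in O -> a \in O -> b \in O -> ~~ small O (a - b) ->
    T_W a (A, B) -> T_W b (A, B) ->
  on_curve A B (Affine a 0) \/ on_curve A B (Affine b 0).
Proof.
move=> OB Oa Ob ab [_ [y [ona ta]]] [_ [z [onb tb]]] /=.
have [y0|y0] := eqVneq y 0; first by left; rewrite -y0.
have [z0|z0] := eqVneq z 0; first by right; rewrite -z0.
by case/negP: ab; apply: (torsion_abscissas_collide OB Oa Ob ona ta y0 onb tb z0).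
Qed.

End SmallTorsion.

(** * The ring of 2-integral algebraic numbers *)

Section TwoIntegralNumbers.
Variables (R : realType) (L : closedFieldType) (iota : {rmorphism Q2 -> L}).
Variables (k : fieldType) (red : {rmorphism ring_of_integers iota -> k}).
Hypothesis hred : is_residue_map red.
Variable i : {rmorphism Qbar R -> L}.

Lemma Zset_subring : subring_closed [in Zset iota i].
Proof.
split=> [|x y|x y]; rewrite /= !in_setE.
- by exists 1.
- by move=> [a _ <-] [b _ <-]; exists (a - b).
- by move=> [a _ <-] [b _ <-]; exists (a * b).
Qed.

(** The residue of [2] vanishes, so [2] is not a unit. *)
Lemma half_notin_Zset (j : {rmorphism 'F_2 -> k}) :
  (2 : R[i])^-1 \notin Zset iota i.
Proof.
rewrite notin_setE => -[z _ zE].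
have z2 : Zsub_val z * 2 = 1.
  apply: (val_inj : injective (@Qbar_val R)).
  rewrite -[LHS]/(Qbar_val (Zsub_val z) * Qbar_val 2) zE.
  by rewrite -[Qbar_val 2]/(2 : R[i]) mulVf // pnatr_eq0.
have w2 : (MkInt (valP z) : ring_of_integers iota) * 2 = 1.
  apply: val_inj; rewrite -[LHS]/(i (Zsub_val z) * int_val 2).
  by rewrite -[int_val 2]/(2 : L) -[2]/(2%:R) -(rmorph_nat i 2) -rmorphM z2 rmorph1.
have : red 2 = 0.
  rewrite -[2]/(2%:R) rmorph_nat -(rmorph_nat j 2).
  by rewrite (_ : 2%:R = 0 :> 'F_2) ?rmorph0 //; apply/val_inj.
move/(congr1 ( *%R (red (MkInt (valP z))))).
by rewrite mulr0 -rmorphM w2 rmorph1 => /eqP; rewrite oner_eq0.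
Qed.

(** Inverses exist in the field of algebraic numbers and an inverse of a unit is
    integral again, so elements with nonzero residue are units. *)
Lemma Zset_sub_unit (a b : Zsub iota i) : rho red a <> rho red b ->
  (Qbar_val a - Qbar_val b)^-1 \in Zset iota i.
Proof.
move=> ab; pose z : ring_of_integers iota := MkInt (valP a) - MkInt (valP b).
have zN0 : red z <> 0 by rewrite rmorphB => /eqP; rewrite subr_eq0 => /eqP.
have [w zw] : exists w, z * w = 1.
  by apply: contrapT => nw; apply: zN0; apply/(hred.2 z).
have {}zw : i (Zsub_val a - Zsub_val b) * int_val w = 1.
  by rewrite rmorphB; exact: (congr1 (@int_val _ _) zw).
have wE : i (Zsub_val a - Zsub_val b)^-1 = int_val w.
  have z0 : i (Zsub_val a - Zsub_val b) != 0.
    by apply/eqP => z0; move/eqP: zw; rewrite z0 mul0r eq_sym oner_eq0.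
  by apply: (mulfI z0); rewrite zw fmorphV divff.
have Zw : (Zsub_val a - Zsub_val b)^-1 \in Zpred iota i.
  by rewrite /in_mem /= /Zpred wE; exact: (valP w).
by rewrite in_setE; exists (MkZsub Zw).
Qed.

End TwoIntegralNumbers.

(** * Simultaneous torsion *)

Theorem corollary15 (R : realType)
  (Q2bar : closedFieldType) (iota : {rmorphism Q2 -> Q2bar})
  (hQ2bar : is_algebraic_closure iota)
  (F2bar : closedFieldType) (j : {rmorphism 'F_2 -> F2bar})
  (hF2bar : is_algebraic_closure j)
  (red : {rmorphism ring_of_integers iota -> F2bar})
  (hred : is_residue_map red)
  (i : {rmorphism Qbar R -> Q2bar})
  (alpha beta gamma : Zsub iota i)
  (hab : rho red alpha <> rho red beta)
  (hac : rho red alpha <> rho red gamma)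
  (hbc : rho red beta <> rho red gamma) :
  let a : R[i] := Qbar_val alpha in
  let b : R[i] := Qbar_val beta in
  let c : R[i] := Qbar_val gamma in
  T_Ws [:: a; b; c] `&` ([set: R[i]] `*` Zset iota i) `<=`
  [set (- (a ^+ 2 + a * b + b ^+ 2), a * b * (a + b));
       (- (a ^+ 2 + a * c + c ^+ 2), a * c * (a + c));
       (- (b ^+ 2 + b * c + c ^+ 2), b * c * (b + c))].
Proof.
move=> a b c [A B] [TAB [_ ZB]].
pose Z : subringClosed R[i] := HB.pack [in Zset iota i]
  (GRing.isSubringClosed.Build R[i] _ (@Zset_subring R Q2bar iota i)).
have two0 : 2 != 0 :> R[i] by rewrite pnatr_eq0.
have [O [ZO O2 valO]] := valuation_ring_exists (rpred_nat Z 2) (half_notin_Zset red i j).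
have small2 : small O 2 by rewrite /small O2 orbT.
have OB : B \in O by apply: ZO; apply/mem_set.
have inO (z : Zsub iota i) : Qbar_val z \in O by apply: ZO; apply/mem_set; exists z.
have apart (z w : Zsub iota i) : rho red z <> rho red w ->
    ~~ small O (Qbar_val z - Qbar_val w).
  move=> zw; rewrite /small negb_or negbK (ZO _ (Zset_sub_unit hred zw)) andbT.
  rewrite subr_eq0; apply/eqP => /val_inj /val_inj zwE; exact/zw/congr1.
have neq (z w : Zsub iota i) : rho red z <> rho red w -> Qbar_val z != Qbar_val w.
  by move=> /apart; apply: contraNneq => ->; rewrite subrr small0.
have Ta : T_W a (A, B) by apply: TAB; rewrite /= mem_head.
have Tb : T_W b (A, B) by apply: TAB; rewrite /= !inE eqxx orbT.
have Tc : T_W c (A, B) by apply: TAB; rewrite /= !inE eqxx !orbT.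
have pair (z w : Zsub iota i) := @torsion_pair _ O valO two0 small2 A B _ _ OB (inO z) (inO w).
have ab := pair _ _ (apart _ _ hab) Ta Tb.
have ac := pair _ _ (apart _ _ hac) Ta Tc.
have bc := pair _ _ (apart _ _ hbc) Tb Tc.
have [Ea|Ea] := pselect (on_curve A B (Affine a 0)).
  have [Eb|Eb] := pselect (on_curve A B (Affine b 0)).
    by have [-> ->] := two_torsion_coefficients Ea Eb (neq _ _ hab); left; left.
  have Ec : on_curve A B (Affine c 0) by case: bc.
  by have [-> ->] := two_torsion_coefficients Ea Ec (neq _ _ hac); left; right.
have Eb : on_curve A B (Affine b 0) by case: ab.
have Ec : on_curve A B (Affine c 0) by case: ac.
by have [-> ->] := two_torsion_coefficients Eb Ec (neq _ _ hbc); right.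
Qed.
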